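(* Let $u_1,\ldots,u_n\in\mathbb{R}^d$ be unit vectors (the opinions of $n$ agents) with zero $d$-th coordinate, $u_i=(u_i^*,0)$ with $u_i^*\in\mathbb{R}^{d-1}$, and let $0\le T<1/3$ be a threshold. One intervention (a unit vector in $\mathbb{R}^d$) is applied to all opinions, with the objective of maximizing the number of agents $i$ such that $\widetilde u_{i,d}>T$. Let $$c:=\frac{2T}{1-3T^2},\qquad z:=\frac{\sqrt{\sqrt{1+3c^2}-1}}{\sqrt{3}\,c},\qquad \beta:=\arccos(z).$$ Then, the number of agents with $\widetilde u_{i,d}>T$ is maximized by applying an intervention $$v:=(\cos\beta\cdot v^*,\ \sin\beta)$$ for a unit vector $v^*\in\mathbb{R}^{d-1}$ that maximizes the number of agents satisfying $\langle u_i^*,v^*\rangle>c$.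
   Context: Applying an intervention (a unit vector) $v\in\mathbb{R}^d$ to the opinions $u_1,\ldots,u_n$ gives the updated opinions $\widetilde u_i=w_i/\|w_i\|$, where $w_i=u_i+\langle u_i,v\rangle v$ and $\|\cdot\|$ is the Euclidean norm (so $\|w_i\|^2=1+3\langle u_i,v\rangle^2\ge 1$). $\widetilde u_{i,d}$ denotes the $d$-th coordinate of $\widetilde u_i$. Vectors of $\mathbb{R}^d$ are written as $(x,y)$ with $x\in\mathbb{R}^{d-1}$, $y\in\mathbb{R}$.
   Formalization: For T = 0 (so c = 0) the formula for z reads 0/0 and is undefined; there z is taken to be its limit 1/√2 as c decreases to 0. For 0 < T < 1/3 the formula for z is used as stated. *)

(* Defs.v *)
From HB Require Import structures.
From mathcomp Require Import all_boot all_order all_algebra.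
From mathcomp Require Import all_classical all_reals all_analysis.
From mathcomp Require Import ring lra.

Set Implicit Arguments.
Unset Strict Implicit.
Unset Printing Implicit Defensive.

Import Order.TTheory GRing.Theory Num.Theory.
Import numFieldNormedType.Exports.

Local Open Scope ring_scope.
Local Open Scope classical_set_scope.

(* The library norm `|u| on 'rV[R]_d is the sup norm, so the Euclidean inner
   product and norm are defined here. *)
Definition dotv (R : realType) (d : nat) (u v : 'rV[R]_d) : R :=
  \sum_(k < d) u 0 k * v 0 k.

Definition enorm (R : realType) (d : nat) (u : 'rV[R]_d) : R :=
  Num.sqrt (dotv u u).

Definition unit_vector (R : realType) (d : nat) (u : 'rV[R]_d) : Prop :=
  enorm u = 1.

Definition update (R : realType) (d : nat) (v u : 'rV[R]_d) : 'rV[R]_d :=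
  let w := u + dotv u v *: v in (enorm w)^-1 *: w.

(* R^d is 'rV[R]_(m + 1) with m = d - 1. *)
Definition vpair (R : realType) (m : nat) (x : 'rV[R]_m) (y : R) :
  'rV[R]_(m + 1) := row_mx x (const_mx y).

Definition last_coord (R : realType) (m : nat) (u : 'rV[R]_(m + 1)) : R :=
  u 0 (rshift m ord0).

Definition num_updated_above (R : realType) (m n : nat) (T : R)
    (u : 'I_n -> 'rV[R]_(m + 1)) (v : 'rV[R]_(m + 1)) : nat :=
  #|[set i : 'I_n | T < last_coord (update v (u i))]%SET|.

Definition num_dot_above (R : realType) (m n : nat) (c : R)
    (u : 'I_n -> 'rV[R]_m) (v : 'rV[R]_m) : nat :=
  #|[set i : 'I_n | c < dotv (u i) v]%SET|.

Definition maximizes (X : Type) (D : X -> Prop) (f : X -> nat) (x : X) : Prop :=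
  D x /\ forall y : X, D y -> (f y <= f x)%N.

Definition cT (R : realType) (T : R) : R := 2 * T / (1 - 3 * T ^+ 2).

Definition zformula (R : realType) (c : R) : R :=
  Num.sqrt (Num.sqrt (1 + 3 * c ^+ 2) - 1) / (Num.sqrt 3 * c).

(* At c = 0 (that is, T = 0) the formula for z reads 0 / 0; z is then its
   limit as c decreases to 0, see zformula_cvg0. *)
Definition zc (R : realType) (c : R) : R :=
  if c == 0 then (Num.sqrt 2)^-1 else zformula c.

Definition betac (R : realType) (c : R) : R := acos (zc c).

Lemma zformula_cvg0 (R : realType) :
  @zformula R x @[x --> 0^'+] --> (Num.sqrt 2 : R)^-1.
Proof.
pose g (x : R) := (Num.sqrt (Num.sqrt (1 + 3 * x ^+ 2) + 1))^-1.
have g0 : g 0 = (Num.sqrt 2)^-1.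
  by rewrite /g expr0n mulr0 addr0 sqrtr1 -[1 + 1]/(2%:R).
have eg : \forall x \near (0 : R)^'+, g x = zformula x.
  near=> x.
  have x0 : 0 < x by near: x; exact: nbhs_right_gt.
  have q0 : 0 < 1 + 3 * x ^+ 2 by nra.
  have s1 : 1 <= Num.sqrt (1 + 3 * x ^+ 2).
    by rewrite -[leLHS]sqrtr1 ler_sqrt//; nra.
  rewrite /g /zformula; set s := Num.sqrt (1 + _) in s1 *.
  have hs : s ^+ 2 = 1 + 3 * x ^+ 2 by rewrite sqr_sqrtr// ltW.
  have -> : Num.sqrt 3 * x = Num.sqrt (s - 1) * Num.sqrt (s + 1).
    rewrite -sqrtrM; last by lra.
    have -> : (s - 1) * (s + 1) = 3 * x ^+ 2 by nra.
    by rewrite sqrtrM// sqrtr_sqr gtr0_norm.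
  have : Num.sqrt (s - 1) != 0 by rewrite gt_eqF// sqrtr_gt0; nra.
  have : Num.sqrt (s + 1) != 0 by rewrite gt_eqF// sqrtr_gt0; nra.
  by move=> h1 h2; field; rewrite h1 h2.
rewrite -g0; apply: (cvg_trans (near_eq_cvg eg)).
apply: cvg_at_right_filter.
apply: cvgV; first by rewrite gt_eqF// sqrtr_gt0 ltr_wpDl// sqrtr_ge0.
apply: (@continuous_comp _ _ _ (fun x : R => Num.sqrt (1 + 3 * x ^+ 2) + 1) Num.sqrt); last exact: sqrt_continuous.
apply: cvgD; last exact: cvg_cst.
apply: (@continuous_comp _ _ _ (fun x : R => 1 + 3 * x ^+ 2) Num.sqrt); last exact: sqrt_continuous.
apply: cvgD; first exact: cvg_cst.
apply: cvgM; first exact: cvg_cst.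
exact: exprn_continuous.
Unshelve. all: by end_near.
Qed.

Lemma maximizes_exists (X : Type) (D : X -> Prop) (f : X -> nat) (N : nat) :
  (exists x, D x) -> (forall x, (f x <= N)%N) -> exists x, maximizes D f x.
Proof.
move=> [x0 Dx0] fN; pose P k := `[< exists2 x, D x & f x = k >].
have exP : exists k, P k by exists (f x0); apply/asboolP; exists x0.
have bP k : P k -> (k <= N)%N by move=> /asboolP[x _ <-].
have [k /asboolP[x Dx fx] kmax] := ex_maxnP exP bP.
by exists x; split=> // y Dy; rewrite fx; apply: kmax; apply/asboolP; exists y.
Qed.

(* A maximizing v^* exists as soon as d >= 2. *)
Lemma exists_best_direction (R : realType) (m n : nat) (c : R)
    (u : 'I_n -> 'rV[R]_m) : (0 < m)%N ->
  exists v, maximizes (@unit_vector R m) (num_dot_above c u) v.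
Proof.
case: m u => // m u _; apply: (@maximizes_exists _ _ _ n); last first.
  by move=> v; rewrite -[leqRHS]card_ord max_card.
exists (delta_mx 0 0); rewrite /unit_vector /enorm /dotv (bigD1 ord0)//= big1.
  by rewrite !mxE !eqxx mulr1 addr0 sqrtr1.
by move=> k k0; rewrite !mxE (negbTE k0) andbF mulr0.
Qed.

(* Main.v *)
(** Write an intervention as v = (x, y), with 1 = |x|^2 + y^2. For an opinion
    u = (u', 0) and p = <u', x>, the last coordinate of the updated opinion is
    p y / sqrt (1 + 3 p^2), so it exceeds T iff p y > 0 and
    p^2 (y^2 - 3 T^2) > T^2. Put p = |x| a. The condition becomes
    a^2 > T^2 / (|x|^2 (y^2 - 3 T^2)), and the two factors in the denominator
    have constant sum 1 - 3 T^2. By AM-GM the threshold on a is therefore at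
    least c, with equality when |x|^2 = (1 - 3 T^2) / 2 = z^2. *)
Require Import Defs.
From mathcomp Require Import all_boot all_order all_algebra.
From mathcomp Require Import all_classical all_reals all_analysis.
From mathcomp Require Import ring lra.
Import Order.TTheory GRing.Theory Num.Theory.
Local Open Scope ring_scope.

Section SingleIntervention.
Set Implicit Arguments.
Unset Strict Implicit.
Context {R : realType}.
Implicit Types T p y : R.

(** * Euclidean inner product and the splitting of [v] as a pair (x, y) *)

Lemma dotvC d (u v : 'rV[R]_d) : dotv u v = dotv v u.
Proof. by apply: eq_bigr => k _; rewrite mulrC. Qed.

Lemma dotvDl d (u v w : 'rV[R]_d) : dotv (u + v) w = dotv u w + dotv v w.
Proof. by rewrite -big_split; apply: eq_bigr => k _; rewrite mxE mulrDl. Qed.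

Lemma dotvZl d (a : R) (u v : 'rV[R]_d) : dotv (a *: u) v = a * dotv u v.
Proof. by rewrite /dotv mulr_sumr; apply: eq_bigr => k _; rewrite mxE mulrA. Qed.

Lemma dotvDr d (u v w : 'rV[R]_d) : dotv u (v + w) = dotv u v + dotv u w.
Proof. by rewrite dotvC dotvDl !(dotvC _ u). Qed.

Lemma dotvZr d (a : R) (u v : 'rV[R]_d) : dotv u (a *: v) = a * dotv u v.
Proof. by rewrite dotvC dotvZl dotvC. Qed.

Lemma dotv0r d (u : 'rV[R]_d) : dotv u 0 = 0.
Proof. by rewrite -(scale0r 0) dotvZr mul0r. Qed.

Lemma dotvv_ge0 d (u : 'rV[R]_d) : 0 <= dotv u u.
Proof. by apply: sumr_ge0 => k _; rewrite -expr2 sqr_ge0. Qed.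

Lemma dotvv_eq0 d (u : 'rV[R]_d) : dotv u u = 0 -> u = 0.
Proof.
move=> u0; apply/rowP => k; rewrite mxE; apply/eqP; rewrite -sqrf_eq0 expr2.
move/eqP: u0; rewrite psumr_eq0 => [/allP/(_ k)|i _]; last by rewrite -expr2 sqr_ge0.
by rewrite mem_index_enum => /(_ isT).
Qed.

Lemma unit_vectorP d (u : 'rV[R]_d) : unit_vector u <-> dotv u u = 1.
Proof.
rewrite /unit_vector /enorm; split=> [h|->]; last exact: sqrtr1.
by rewrite -(sqr_sqrtr (dotvv_ge0 u)) h expr1n.
Qed.

Lemma dotv_vpair m (x x' : 'rV[R]_m) (y y' : R) :
  dotv (vpair x y) (vpair x' y') = dotv x x' + y * y'.
Proof.
rewrite /dotv big_split_ord /= big_ord1 /vpair !row_mxEr !mxE.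
by congr (_ + _); apply: eq_bigr => k _; rewrite !row_mxEl.
Qed.

Lemma vpair_eta m (v : 'rV[R]_(m + 1)) : v = vpair (lsubmx v) (last_coord v).
Proof.
rewrite -[LHS]hsubmxK /vpair; congr row_mx; apply/rowP => k.
by rewrite !mxE ord1.
Qed.

(** * The last coordinate of one updated opinion *)

Lemma last_coord_update m (x' x : 'rV[R]_m) (y : R) :
  unit_vector (vpair x' 0) -> unit_vector (vpair x y) ->
  last_coord (update (vpair x y) (vpair x' 0)) =
  dotv x' x * y / Num.sqrt (1 + 3 * dotv x' x ^+ 2).
Proof.
move=> /unit_vectorP hu /unit_vectorP hv.
have uv : dotv (vpair x' 0) (vpair x y) = dotv x' x.
  by rewrite dotv_vpair mul0r addr0.
rewrite /last_coord /update /enorm uv dotvDl !dotvDr !dotvZl !dotvZr.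
rewrite (dotvC (vpair x y)) uv hu hv /vpair scale_row_mx add_row_mx mxE row_mxEr !mxE add0r mulrC.
by congr (_ / Num.sqrt _); ring.
Qed.

(** Since [T] is nonnegative and the root positive, the left side forces [p * y] to be positive;
    once that is known, squaring loses nothing. *)
Lemma lt_div_sqrtP T p y : 0 <= T ->
  (T < p * y / Num.sqrt (1 + 3 * p ^+ 2)) =
  (0 < p * y) && (T ^+ 2 < p ^+ 2 * (y ^+ 2 - 3 * T ^+ 2)).
Proof.
move=> T0; have q0 : 0 < 1 + 3 * p ^+ 2 by nra.
rewrite ltr_pdivlMr ?sqrtr_gt0//.
have s0 : 0 <= T * Num.sqrt (1 + 3 * p ^+ 2) by rewrite mulr_ge0 ?sqrtr_ge0.
have -> : (T ^+ 2 < p ^+ 2 * (y ^+ 2 - 3 * T ^+ 2)) =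
          ((T * Num.sqrt (1 + 3 * p ^+ 2)) ^+ 2 < (p * y) ^+ 2).
  rewrite exprMn sqr_sqrtr ?ltW// -subr_gt0 -[RHS]subr_gt0.
  by congr (0 < _); ring.
have [py0|py0] := ltP 0 (p * y); first by rewrite ltr_pXn2r ?nnegrE // ltW.
by apply/negbTE; rewrite -leNgt (le_trans py0).
Qed.

(** * The angle [betac] and the optimal threshold [cT] *)

Lemma three_sqr_lt1 T : 0 <= T -> T < 1 / 3 -> 3 * T ^+ 2 < 1.
Proof. nra. Qed.

Lemma cT_ge0 T : 0 <= T -> T < 1 / 3 -> 0 <= cT T.
Proof.
move=> T0 T1; have T3 := three_sqr_lt1 T0 T1.
by rewrite divr_ge0 ?mulr_ge0// subr_ge0 ltW.
Qed.

Lemma zc_ge0 T : 0 <= T -> T < 1 / 3 -> 0 <= zc (cT T).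
Proof.
move=> T0 T1; rewrite /zc; case: ifP => _; first by rewrite invr_ge0 sqrtr_ge0.
by rewrite divr_ge0 ?sqrtr_ge0// (mulr_ge0 (sqrtr_ge0 _) (cT_ge0 T0 T1)).
Qed.

(** The nested root collapses because 1 + 3c^2 is a perfect square as a function of [T]. The value
    is the equality point of AM-GM. *)
Lemma sqr_zc_cT T : 0 <= T -> T < 1 / 3 -> zc (cT T) ^+ 2 = (1 - 3 * T ^+ 2) / 2.
Proof.
move=> T0 T1; have T3 := three_sqr_lt1 T0 T1.
have D0 : 1 - 3 * T ^+ 2 != 0 by rewrite gt_eqF// subr_gt0.
(* The case c = 0 means T = 0, where the limit value 1/sqrt 2 has the required square 1/2. *)
rewrite /zc; case: ifPn => [|c0].
  rewrite /cT mulf_eq0 invr_eq0 (negbTE D0) orbF mulf_eq0 pnatr_eq0 /= => /eqP ->.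
  by rewrite exprVn sqr_sqrtr// expr0n /= mulr0 subr0 mul1r.
have Tn0 : T != 0 by apply: contraNneq c0 => ->; rewrite /cT mulr0 mul0r.
have e : 1 + 3 * cT T ^+ 2 = ((1 + 3 * T ^+ 2) / (1 - 3 * T ^+ 2)) ^+ 2.
  by rewrite /cT; field.
have e' : Num.sqrt (1 + 3 * cT T ^+ 2) - 1 = 6 * T ^+ 2 / (1 - 3 * T ^+ 2).
  rewrite e sqrtr_sqr ger0_norm; first by field.
  by rewrite divr_ge0 ?subr_ge0 ?(ltW T3)//; nra.
rewrite /zformula e' expr_div_n (exprMn _ (Num.sqrt 3)) !sqr_sqrtr//; last first.
  by rewrite divr_ge0 ?subr_ge0 ?(ltW T3)//; nra.
by rewrite /cT; field; rewrite Tn0 D0.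
Qed.

Lemma cos_betac T : 0 <= T -> T < 1 / 3 -> cos (betac (cT T)) = zc (cT T).
Proof.
move=> T0 T1; have z0 := zc_ge0 T0 T1; have z2 := sqr_zc_cT T0 T1.
by rewrite acosK// in_itv /=; apply/andP; split; nra.
Qed.

Lemma sqr_sin_betac T : 0 <= T -> T < 1 / 3 ->
  sin (betac (cT T)) ^+ 2 = (1 + 3 * T ^+ 2) / 2.
Proof.
by move=> T0 T1; rewrite sin2cos2 cos_betac// sqr_zc_cT//; field.
Qed.

Lemma sin_betac_gt0 T : 0 <= T -> T < 1 / 3 -> 0 < sin (betac (cT T)).
Proof.
move=> T0 T1; have z0 := zc_ge0 T0 T1; have z2 := sqr_zc_cT T0 T1.
have zi : -1 <= zc (cT T) <= 1 by apply/andP; split; nra.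
have s0 : 0 <= sin (betac (cT T)) by rewrite sin_ge0_pi// acos_ge0//= acos_lepi.
by have := sqr_sin_betac T0 T1; nra.
Qed.

(** At this angle both AM-GM factors, cos^2 and sin^2 - 3T^2, equal (1 - 3T^2)/2, so the second
    condition becomes c^2 < a^2. The first one says that [a] is positive, as cos and sin are. *)
Lemma betac_thresholdE T (a : R) : 0 <= T -> T < 1 / 3 ->
  let p := cos (betac (cT T)) * a in
  (0 < p * sin (betac (cT T))) &&
    (T ^+ 2 < p ^+ 2 * (sin (betac (cT T)) ^+ 2 - 3 * T ^+ 2)) = (cT T < a).
Proof.
move=> T0 T1 p; have T3 := three_sqr_lt1 T0 T1.
have s0 := sin_betac_gt0 T0 T1; have z2 := sqr_zc_cT T0 T1.
have z0 : 0 < zc (cT T) by have := zc_ge0 T0 T1; nra.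
have c0 := cT_ge0 T0 T1.
rewrite pmulr_lgt0// /p cos_betac// pmulr_rgt0// exprMn z2 sqr_sin_betac//.
have -> : (T ^+ 2 < (1 - 3 * T ^+ 2) / 2 * a ^+ 2 *
            ((1 + 3 * T ^+ 2) / 2 - 3 * T ^+ 2)) = (cT T ^+ 2 < a ^+ 2).
  rewrite /cT expr_div_n ltr_pdivrMr ?exprn_gt0 ?subr_gt0//.
  by apply/idP/idP => h; nra.
have [a0|a0] := ltP 0 a; first by rewrite ltr_pXn2r ?nnegrE // ltW.
by apply/esym/negbTE; rewrite -leNgt (le_trans a0).
Qed.

(** Here sqrt(1 - y^2) is |x|, so this is c < a with denominators cleared, where a = p y / (|x| |y|)
    is the inner product with the unit vector along x, signed by y. *)
Lemma cT_le_threshold T p y : 0 <= T -> T < 1 / 3 ->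
  0 < p * y -> T ^+ 2 < p ^+ 2 * (y ^+ 2 - 3 * T ^+ 2) -> y ^+ 2 <= 1 ->
  cT T * (Num.sqrt (1 - y ^+ 2) * `|y|) < p * y.
Proof.
move=> T0 T1 py0 h y1; have T3 := three_sqr_lt1 T0 T1.
have D0 : 0 < 1 - 3 * T ^+ 2 by rewrite subr_gt0.
have Y0 : 0 < y ^+ 2 - 3 * T ^+ 2 by nra.
have y0 : 0 < y ^+ 2 by nra.
(* AM-GM on [1 - y^2] and [y^2 - 3 T^2] *)
have amgm : 4 * (1 - y ^+ 2) * (y ^+ 2 - 3 * T ^+ 2) <= (1 - 3 * T ^+ 2) ^+ 2.
  by have := sqr_ge0 ((1 - y ^+ 2) - (y ^+ 2 - 3 * T ^+ 2)); nra.
have key : 4 * T ^+ 2 * (1 - y ^+ 2) < p ^+ 2 * (1 - 3 * T ^+ 2) ^+ 2.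
  (* With the factor y^2 - 3T^2 on both sides, the AM-GM bound and then [h] apply in succession. *)
  rewrite -(ltr_pM2r Y0).
  apply: (@le_lt_trans _ _ (T ^+ 2 * (1 - 3 * T ^+ 2) ^+ 2)).
    have -> : 4 * T ^+ 2 * (1 - y ^+ 2) * (y ^+ 2 - 3 * T ^+ 2) =
      T ^+ 2 * (4 * (1 - y ^+ 2) * (y ^+ 2 - 3 * T ^+ 2)) by ring.
    by rewrite ler_wpM2l ?sqr_ge0.
  by rewrite [ltRHS]mulrAC ltr_pM2r ?exprn_gt0.
have c0 := cT_ge0 T0 T1.
have r0 : 0 <= Num.sqrt (1 - y ^+ 2) * `|y| by rewrite mulr_ge0 ?sqrtr_ge0.
rewrite -(@ltr_pXn2r _ 2)// ?nnegrE ?(ltW py0) ?(mulr_ge0 c0 r0)//.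
rewrite (exprMn _ (cT T)) (exprMn _ (Num.sqrt _)) (exprMn _ p).
rewrite sqr_sqrtr ?subr_ge0// real_normK ?num_real// mulrA ltr_pM2r//.
rewrite /cT expr_div_n mulrAC ltr_pdivrMr ?exprn_gt0//.
by rewrite exprMn -natrX.
Qed.

(** * Counting agents and comparing interventions *)

Lemma num_updated_aboveE (m n : nat) (T : R)
    (u : 'I_n -> 'rV[R]_(m + 1)) (ustar : 'I_n -> 'rV[R]_m)
    (x : 'rV[R]_m) (y : R) : 0 <= T ->
  (forall i, unit_vector (u i)) -> (forall i, u i = vpair (ustar i) 0) ->
  unit_vector (vpair x y) ->
  num_updated_above T u (vpair x y) =
  #|[set i | (0 < dotv (ustar i) x * y) &&
      (T ^+ 2 < dotv (ustar i) x ^+ 2 * (y ^+ 2 - 3 * T ^+ 2))]%SET|.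
Proof.
move=> T0 hunit hu hv; apply: eq_card => i; rewrite !inE.
by rewrite hu last_coord_update -?hu// lt_div_sqrtP.
Qed.

(** The direction [e] is the normalized x-part of [v], up to sign; [e0] stands in for it when x = 0
    or y = 0. *)
Lemma num_updated_above_le (m n : nat) (T : R)
    (u : 'I_n -> 'rV[R]_(m + 1)) (ustar : 'I_n -> 'rV[R]_m)
    (v : 'rV[R]_(m + 1)) (e0 : 'rV[R]_m) : 0 <= T -> T < 1 / 3 ->
  (forall i, unit_vector (u i)) -> (forall i, u i = vpair (ustar i) 0) ->
  unit_vector v -> unit_vector e0 ->
  exists2 e : 'rV[R]_m, unit_vector e &
    (num_updated_above T u v <= num_dot_above (cT T) ustar e)%N.
Proof.
move=> T0 T1 hunit hu; rewrite (vpair_eta v).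
move: (lsubmx v) (last_coord v) => x y hv e0_unit.
rewrite (num_updated_aboveE T0 hunit hu hv).
have /unit_vectorP := hv; rewrite dotv_vpair -expr2 => xy1.
have x2 : dotv x x = 1 - y ^+ 2 by rewrite -xy1 addrK.
have y1 : y ^+ 2 <= 1 by rewrite -subr_ge0 -x2 dotvv_ge0.
(* If x = 0 or y = 0, then p y = 0 for every agent and nobody is counted. *)
have [xy0|xy0] := eqVneq (Num.sqrt (1 - y ^+ 2) * `|y|) 0.
  exists e0 => //; rewrite [X in (X <= _)%N](_ : _ = 0%N)//.
  apply: eq_card0 => i; rewrite !inE; apply/negbTE; rewrite negb_and.
  apply/orP; left; rewrite -leNgt.
  move/eqP: xy0; rewrite mulf_eq0 normr_eq0 => /orP[|/eqP ->].
    rewrite sqrtr_eq0 -x2 => x0; have /dotvv_eq0 -> : dotv x x = 0.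
      by apply/le_anti; rewrite x0 dotvv_ge0.
    by rewrite dotv0r mul0r.
  by rewrite mulr0.
have r0 : 0 < Num.sqrt (1 - y ^+ 2) * `|y|.
  by rewrite lt_neqAle eq_sym xy0 mulr_ge0 ?sqrtr_ge0.
(* This is sign(y) x/|x|. The sign reflects that [v] and its opposite have the same effect, so y may
   be taken positive. *)
exists ((y / (Num.sqrt (1 - y ^+ 2) * `|y|)) *: x).
  apply/unit_vectorP; rewrite dotvZl dotvZr x2 mulrA -expr2 expr_div_n exprMn.
  rewrite sqr_sqrtr ?subr_ge0// real_normK ?num_real//.
  move: xy0; rewrite mulf_eq0 negb_or sqrtr_eq0 normr_eq0 -ltNge => /andP[h1 h2].
  by field; rewrite h2 gt_eqF.
apply: subset_leq_card; apply/fintype.subsetP => i; rewrite !inE => /andP[h1 h2].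
rewrite dotvZr mulrAC ltr_pdivlMr// (mulrC y).
exact: cT_le_threshold.
Qed.

End SingleIntervention.

Theorem proposition5p2 (R : realType) (m n : nat)
    (u : 'I_n -> 'rV[R]_(m + 1)) (ustar : 'I_n -> 'rV[R]_m) (T : R)
    (hunit : forall i : 'I_n, unit_vector (u i))
    (hu : forall i : 'I_n, u i = vpair (ustar i) 0)
    (hT0 : 0 <= T) (hT1 : T < 1 / 3) :
  let c := cT T in
  let beta := betac c in
  forall vstar : 'rV[R]_m,
    maximizes (@unit_vector R m) (num_dot_above c ustar) vstar ->
    maximizes (@unit_vector R (m + 1)) (num_updated_above T u)
      (vpair (cos beta *: vstar) (sin beta)).
Proof.
move=> c beta vstar [vstar_unit vstar_max].
have v_unit : unit_vector (vpair (cos beta *: vstar) (sin beta)).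
  apply/unit_vectorP; rewrite dotv_vpair dotvZl dotvZr.
  by move/unit_vectorP: vstar_unit => ->; rewrite mulr1 -!expr2 cos2Dsin2.
split=> // v hv.
(* [vstar] also serves as the fallback direction. The counts then increase from [v] to [e], to
   [vstar], to the proposed intervention. *)
have [e e_unit] := num_updated_above_le hT0 hT1 hunit hu hv vstar_unit.
move=> /leq_trans; apply; apply: (leq_trans (vstar_max e e_unit)).
rewrite (num_updated_aboveE hT0 hunit hu v_unit) /num_dot_above.
apply: subset_leq_card; apply/fintype.subsetP => i; rewrite !inE => h.
by rewrite dotvZr betac_thresholdE.
Qed.
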